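(* There are absolute constants $C_1,C_2,C_3,c>0$ such that for every integer $k\ge 2$ there exists a graph $G$ with $2^{c k^4\log^3 k}\le |V(G)|\le 2^{C_1 k^4\log^3 k}$ vertices such that $\mathrm{bp}(G)\le 2^{C_2 k\log^4 k}$ and $\chi(G)\ge 2^{C_3 k^2}$.
   Context: For a graph $G$, $\chi(G)$ is its chromatic number and $\mathrm{bp}(G)$, the biclique partition number, is the smallest number of complete bipartite subgraphs (bicliques) whose edge sets partition $E(G)$. *)

(* Defs.v *)
From mathcomp Require Import all_boot.
From Stdlib Require Import Reals ClassicalEpsilon.

Set Implicit Arguments.
Unset Strict Implicit.
Unset Printing Implicit Defensive.

Definition simple_graph (T : finType) (e : rel T) : Prop :=
  symmetric e /\ irreflexive e.

Definition decide (P : Prop) : bool :=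
  if excluded_middle_informative P then true else false.

Lemma decideP (P : Prop) : reflect P (decide P).
Proof.
rewrite /decide; case: excluded_middle_informative => h; by constructor.
Qed.

Definition min_nat (P : nat -> Prop) : nat :=
  match excluded_middle_informative (exists n, P n) with
  | left h =>
      @ex_minn (fun n => decide (P n))
        (let: ex_intro n Hn := h in ex_intro _ n (introT (decideP _) Hn))
  | right _ => 0
  end.

Definition colorable (T : finType) (e : rel T) (n : nat) : Prop :=
  exists f : T -> 'I_n, forall x y, e x y -> f x != f y.

Definition chromatic_number (T : finType) (e : rel T) : nat :=
  min_nat (colorable e).

Definition is_biclique (T : finType) (e : rel T) (A B : {set T}) : Prop :=
  A != set0 /\ B != set0 /\ [disjoint A & B] /\
  (forall a b, a \in A -> b \in B -> e a b).

Definition biclique_partition (T : finType) (e : rel T) (m : nat)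
    (A B : 'I_m -> {set T}) : Prop :=
  (forall i, is_biclique e (A i) (B i)) /\
  (forall x y, e x y ->
     #|[set i | ((x \in A i) && (y \in B i)) || ((y \in A i) && (x \in B i))]| = 1).

Definition bp (T : finType) (e : rel T) : nat :=
  min_nat (fun m => exists A B : 'I_m -> {set T}, biclique_partition e A B).

(* Main.v *)
Require Import Defs.
From mathcomp Require Import all_boot zify.
From Stdlib Require Import Classical.
Set Implicit Arguments.
Unset Strict Implicit.
Unset Printing Implicit Defensive.

(** Let n = k ^ 2. Take a Boolean k x k matrix x and let row i win if at most half of its entries
    are zero and, in every other row i', a small set of probed entries is all zero. The probes come
    from random sets r l i of size at most 2 ^ l such that a set E of at most half of the columns
    contains at most 2k / 2 ^ l of the sets r l i. Row i, with zero set E, probes row i' with the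
    set r l i for the least l such that no r l' i' with l' >= l is contained in E. Two rows cannot
    both win, since each would have to probe the other one strictly deeper. A winning row is
    certified by O(k log k) entries, whereas the matrix 0 stays undecided as long as some row is at
    most half read, which takes about n / 2 entries.

    Replace each entry by an index gadget (a point of V for Alice, a subset of V for Bob, the value
    is membership) with V of constant size. An induction on the number of entries shows that a
    rectangle without winning rows contains at most a fraction 4 ^ (- n) of the all-zero pairs.
    Join two all-zero pairs (X, Y), (X', Y') when (X, Y') or (X', Y) has a winning row: independent
    sets span such rectangles, so the chromatic number is at least 4 ^ n, while certificates give
    2 ^ O(k log k) oriented bicliques covering every arc once. An edge may be an arc in both
    directions, hence the graph is either replaced by its double edges or restricted to a class of
    a colouring of these. Vertices are finally duplicated to reach the prescribed order. *)

(** * Rectangles avoiding a robust set of patterns *)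

Lemma sum_tupleS (T : finType) (n : nat) (F : n.+1.-tuple T -> nat) :
  \sum_X F X = \sum_x \sum_(X : n.-tuple T) F [tuple of x :: X].
Proof.
rewrite pair_bigA /=.
rewrite (reindex (fun p : T * n.-tuple T => [tuple of p.1 :: p.2])) //.
exists (fun X : n.+1.-tuple T => (thead X, [tuple of behead X])).
  by move=> [x X] _ /=; congr pair; apply/val_inj.
by move=> X _; rewrite /= -tuple_eta.
Qed.

Section SetCounts.
Variable V : finType.
Implicit Types (Z U : {set V}) (x : V).

Lemma card_subsets Z : #|[set U : {set V} | U \subset Z]| = 2 ^ #|Z|.
Proof. by rewrite -card_powerset; apply: eq_card => U; rewrite !inE. Qed.

Lemma card_avoiding Z : #|[set U : {set V} | [disjoint Z & U]]| <= 2 ^ (#|V| - #|Z|).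
Proof.
have <- : #|~: Z| = #|V| - #|Z| by rewrite -(cardsC Z) addKn.
rewrite -card_subsets; apply: subset_leq_card; apply/subsetP => U.
by rewrite !inE disjoint_sym disjoints_subset.
Qed.

Lemma card_supsets Z : #|[set U : {set V} | Z \subset U]| <= 2 ^ (#|V| - #|Z|).
Proof.
rewrite -(card_imset _ (can_inj (@setCK V))).
apply: leq_trans (card_avoiding Z); apply: subset_leq_card.
by apply/subsetP => W /imsetP[U]; rewrite !inE => ZU ->; rewrite disjoints_subset setCK.
Qed.

Lemma card_pointed_subsets x Z : x \notin Z ->
  2 ^ (#|V| - #|Z|.+1) <= #|[set U : {set V} | (x \in U) && [disjoint Z & U]]|.
Proof.
move=> xZ.
have -> : #|V| - #|Z|.+1 = #|~: (x |: Z)|.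
  by rewrite -(cardsC (x |: Z)) cardsU1 xZ addnC addnK.
rewrite -card_subsets -(@card_in_imset _ _ (fun U => x |: U)); last first.
  move=> U W; rewrite !inE => /subsetP hU /subsetP hW /setP e.
  apply/setP=> y; have := e y; rewrite !inE; case: eqP => [-> _|//].
  have nx S : {subset S <= ~: (x |: Z)} -> x \in S = false.
    by move=> hS; apply/negP => /hS; rewrite !inE eqxx.
  by rewrite !nx.
apply: subset_leq_card; apply/subsetP => W /imsetP[U]; rewrite inE => hU ->.
rewrite inE setU11 disjoints_subset; apply/subsetP=> y yZ.
rewrite !inE negb_or; apply/andP; split; first by apply: contraNneq xZ => <-.
by apply/negP => /(subsetP hU); rewrite !inE yZ orbT.
Qed.
End SetCounts.

Section RectangleBound.
Variables (V : finType) (h e : nat).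
Let m := #|V|.
Hypothesis eh : e + 2 <= h.
Hypothesis hm : h * 2 ^ (h + e + 1) <= m.

Definition pattern (X : seq V) (Y : seq {set V}) : seq bool :=
  [seq p.1 \in p.2 | p : V * {set V} <- zip X Y].

Definition zero_pattern X Y := ~~ has id (pattern X Y).

Definition zero_mass n (A : pred (n.-tuple V)) (B : pred (n.-tuple {set V})) : nat :=
  \sum_(X | A X) \sum_(Y | B Y) zero_pattern X Y.

(** The ones of [M] mark positions read as zero: certifying at the all-zero pattern that [P] fails
    takes at least [s] entries. *)
Definition robust n s (P : pred (seq bool)) := forall M : seq bool, size M = n ->
  count id M < s -> exists z, [/\ size z = n, P z & all2 (fun b c => ~~ (b && c)) M z].

Lemma robust_free n s P : robust n.+1 s P ->
  robust n s [pred z | P (false :: z) || P (true :: z)].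
Proof.
move=> rP M sM cM; have [|//|[|b z] [//= [sz] Pz]] := rP (false :: M) _ _; first by rewrite /= sM.
by move=> Mz; exists z; split=> //=; case: b Pz => ->; rewrite ?orbT.
Qed.

(** Prefixing [M] with [true] reads the split coordinate as zero, at the cost of one unit of [s]. *)
Lemma robust_fixed n s P : robust n.+1 s.+1 P -> robust n s [pred z | P (false :: z)].
Proof.
move=> rP M sM cM; have [|//|[|[] z] [//= [sz] Pz]] := rP (true :: M) _ _; first by rewrite /= sM.
by move=> Mz; exists z.
Qed.


Lemma zero_massS n (A : pred (n.+1.-tuple V)) (B : pred (n.+1.-tuple {set V})) :
  zero_mass A B = \sum_(X : n.-tuple V) \sum_(Y : n.-tuple {set V}) zero_pattern X Y *
    \sum_(x | A [tuple of x :: X]) #|[set y | B [tuple of y :: Y] & x \notin y]|.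
Proof.
rewrite /zero_mass big_mkcond sum_tupleS exchange_big /=; apply: eq_bigr => X _.
rewrite [RHS](eq_bigr (fun Y : n.-tuple {set V} => \sum_x if A [tuple of x :: X]
  then zero_pattern X Y * #|[set y | B [tuple of y :: Y] & x \notin y]| else 0)); last first.
  by move=> Y _; rewrite big_distrr big_mkcond.
rewrite [RHS]exchange_big /=; apply: eq_bigr => x _.
case: ifP => _; last by rewrite big1.
rewrite big_mkcond sum_tupleS exchange_big /=; apply: eq_bigr => Y _.
rewrite -sum1_card big_distrr /= [RHS]big_mkcond /=; apply: eq_bigr => y _.
rewrite inE /zero_pattern /=; case: (B _) => //=.
by case: (x \in y) => //=; rewrite muln1.
Qed.

Definition fiber (H : {set V}) (K : {set {set V}}) : nat :=
  \sum_(x in H) #|[set y in K | x \notin y]|.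

Lemma card_missing x (K : {set {set V}}) : #|[set y in K | x \notin y]| <= 2 ^ m.-1.
Proof.
apply: leq_trans (_ : #|[set y : {set V} | [disjoint [set x] & y]]| <= _).
  by apply: subset_leq_card; apply/subsetP=> y; rewrite !inE disjoints1 => /andP[].
by have := card_avoiding [set x]; rewrite cards1 subn1.
Qed.

Lemma fiber_le H K : fiber H K <= #|H| * 2 ^ m.-1.
Proof. by rewrite -sum_nat_const; apply: leq_sum => x _; apply: card_missing. Qed.

(** If only the bit [~~ b] occurred, all sets of [K] would be disjoint from [H], or all would
    contain it; at most [2 ^ (m - h)] sets do so. *)
Lemma heavy_fiber_bits (H : {set V}) (K : {set {set V}}) (b : bool) :
  h <= #|H| -> 2 ^ (m - h) < #|K| -> exists x y, [/\ x \in H, y \in K & (x \in y) = b].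
Proof.
move=> hH hK.
case: (boolP [exists x in H, [exists y in K, (x \in y) == b]]).
  by case/exists_inP=> x xH /exists_inP[y yK /eqP]; exists x, y.
rewrite negb_exists_in => /forall_inP no; exfalso.
have {}no x y : x \in H -> y \in K -> (x \in y) = ~~ b.
  move=> xH yK; have := no x xH; rewrite negb_exists_in => /forall_inP /(_ y yK).
  by case: (_ \in _); case: (b).
have le2 : 2 ^ (m - #|H|) <= 2 ^ (m - h) by rewrite leq_exp2l // leq_sub2l.
move: hK; rewrite ltnNge => /negP; apply; apply: leq_trans le2.
case: b no => no.
  apply: leq_trans (card_avoiding H); apply: subset_leq_card; apply/subsetP=> y yK.
  by rewrite inE disjoints_subset; apply/subsetP=> x xH; rewrite inE no.
apply: leq_trans (card_supsets H); apply: subset_leq_card; apply/subsetP=> y yK.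
by rewrite inE; apply/subsetP=> x xH; rewrite no.
Qed.

Lemma heavy_core (K : {set {set V}}) : 2 ^ (m - h) < #|K| -> #|\bigcap_(y in K) y| < h.
Proof.
apply: contraTltn => hZ; rewrite -leqNgt.
apply: leq_trans (_ : 2 ^ (m - #|\bigcap_(y in K) y|) <= _); last first.
  by rewrite leq_exp2l // leq_sub2l.
apply: leq_trans (card_supsets _); apply: subset_leq_card; apply/subsetP=> y yK.
by rewrite inE bigcap_inf.
Qed.

(** The fibre vanishes if [H] lies in the core of [K]. Otherwise some [x] of [H] lies outside, and
    at least [2 ^ (m - h)] sets [U] contain [x] and miss the core. For fixed [U] the condition
    separates into one on [H] and one on [K]. *)
Lemma fiber_light_left (H : {set V}) (K : {set {set V}}) :
  #|H| < h -> 2 ^ (m - h) < #|K| ->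
  fiber H K * 2 ^ (m - h) <= h * 2 ^ m.-1 *
    \sum_(U : {set V}) ~~ [disjoint H & U] * [disjoint \bigcap_(y in K) y & U].
Proof.
move=> hH hK; set Z := \bigcap_(y in K) y.
case: (boolP (H \subset Z)) => [/subsetP HZ|].
  rewrite /fiber big1 ?mul0n // => x /HZ /bigcapP xZ.
  by apply/eqP; rewrite cards_eq0; apply/eqP/setP=> y; rewrite !inE; case: (boolP (y \in K)) => // /xZ ->.
case/subsetPn => x xH xZ; apply: leq_mul.
  by apply: leq_trans (fiber_le H K) _; rewrite leq_mul2r ltnW ?orbT.
apply: leq_trans (_ : 2 ^ (m - #|Z|.+1) <= _).
  by rewrite leq_exp2l // leq_sub2l // heavy_core.
apply: leq_trans (card_pointed_subsets xZ) _.
rewrite -sum1_card big_mkcond /=; apply: leq_sum => U _; rewrite inE.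
case: (boolP (x \in U)) => //= xU; case: (boolP [disjoint Z & U]) => // _.
by rewrite (_ : ~~ _) //; apply/pred0Pn; exists x; rewrite /= xH.
Qed.

Lemma fiber_light_right (H : {set V}) (K : {set {set V}}) : #|K| <= 2 ^ (m - h) ->
  fiber H K <= 2 ^ (m - h) * \sum_x ((x \in H) && [exists y in K, x \notin y]).
Proof.
move=> hK; rewrite /fiber big_mkcond big_distrr /=; apply: leq_sum => x _.
case: ifP => // _; case: (boolP [exists y in K, x \notin y]) => /= [_|].
  rewrite muln1; apply: leq_trans hK; apply: subset_leq_card.
  by apply/subsetP=> y; rewrite inE => /andP[].
rewrite negb_exists_in => /forall_inP no; rewrite muln0 leqn0 cards_eq0.
by apply/eqP/setP=> y; rewrite !inE; case: (boolP (y \in K)) => // /no /negbTE ->.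
Qed.

Lemma zero_mass_fiber n (A : pred (n.+1.-tuple V)) (B : pred (n.+1.-tuple {set V})) :
  zero_mass A B = \sum_(X : n.-tuple V) \sum_(Y : n.-tuple {set V}) zero_pattern X Y *
    fiber [set x | A [tuple of x :: X]] [set y | B [tuple of y :: Y]].
Proof.
rewrite zero_massS; apply: eq_bigr => X _; apply: eq_bigr => Y _; congr (_ * _).
apply: eq_big => [x|x _]; first by rewrite inE.
by apply: eq_card => y; rewrite !inE.
Qed.

Lemma zero_mass_le n (A : pred (n.-tuple V)) (B : pred (n.-tuple {set V})) :
  zero_mass A B <= (m * 2 ^ m.-1) ^ n.
Proof.
elim: n A B => [|n IH] A B.
  apply: leq_trans (_ : \sum_(X : 0.-tuple V) \sum_(Y : 0.-tuple {set V}) 1 <= _); last first.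
    by rewrite !sum_nat_const !card_tuple.
  rewrite /zero_mass big_mkcond; apply: leq_sum => X _; case: (A X) => //.
  by rewrite big_mkcond; apply: leq_sum => Y _; case: (B Y) => //; apply: leq_b1.
rewrite zero_mass_fiber expnS.
apply: leq_trans (_ : m * 2 ^ m.-1 * zero_mass (n := n) predT predT <= _); last by rewrite leq_mul2l IH orbT.
rewrite /zero_mass big_distrr; apply: leq_sum => X _; rewrite big_distrr; apply: leq_sum => Y _.
rewrite mulnC leq_mul2r; apply/orP; right.
by apply: leq_trans (fiber_le _ _) _; rewrite leq_mul2r max_card orbT.
Qed.

Lemma zero_mass_indicator n (A : pred (n.-tuple V)) (B : pred (n.-tuple {set V})) :
  zero_mass A B = \sum_(X : n.-tuple V) \sum_(Y : n.-tuple {set V}) zero_pattern X Y * (A X && B Y).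
Proof.
rewrite /zero_mass big_mkcond; apply: eq_bigr => X _.
case: (A X) => /=; last by rewrite big1 // => Y _; rewrite muln0.
by rewrite big_mkcond; apply: eq_bigr => Y _; case: (B Y); rewrite ?muln1 ?muln0.
Qed.

Lemma zero_mass_sum n (W : finType) (a : W -> pred (n.-tuple V)) (b : W -> pred (n.-tuple {set V})) :
  \sum_(X : n.-tuple V) \sum_(Y : n.-tuple {set V})
     zero_pattern X Y * \sum_w (a w X && b w Y) = \sum_w zero_mass (a w) (b w).
Proof.
under [RHS]eq_bigr => w _ do rewrite zero_mass_indicator.
rewrite [RHS]exchange_big; apply: eq_bigr => X _.
rewrite [RHS]exchange_big; apply: eq_bigr => Y _.
by rewrite big_distrr.
Qed.

(* Split off one coordinate. A tail X (resp. Y) is heavy if at least h points (resp. more than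
   2 ^ (m - h) sets) extend it. Heavy pairs extend to both bits, so their tails avoid P with a free
   first bit. Light Y cost a factor 2 ^ (1 - h); a light X costs h * 2 ^ h / m, the 2 ^ h coming from
   averaging over U, which turns the pairs extendable by a 0 into rectangles. *)
Lemma rectangle_bound n s (P : pred (seq bool)) (A : pred (n.-tuple V)) (B : pred (n.-tuple {set V})) :
  robust n s P -> (forall X Y, A X -> B Y -> ~~ P (pattern X Y)) ->
  zero_mass A B * 2 ^ (e * s) <= 2 ^ n * (m * 2 ^ m.-1) ^ n.
Proof.
elim: n s P A B => [|n IH] [|s] P A B rP avoid.
- by rewrite muln0 muln1 expn0 mul1n zero_mass_le.
(* With no coordinate left and [s] positive, robustness puts the empty pattern into [P], so the
   rectangle is empty. *)
- rewrite /zero_mass big1 // => X AX; rewrite big1 // => Y BY.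
  have [|//|z [/size0nil -> Pz _]] := rP [::]; first by [].
  by have := avoid X Y AX BY; rewrite [X]tuple0 [Y]tuple0 /= Pz.
- rewrite muln0 muln1; apply: leq_trans (zero_mass_le _ _) _.
  by rewrite leq_pmull // expn_gt0.
set T := m * 2 ^ m.-1 in IH *; set q := 2 ^ n * T ^ n in IH *.
pose H (X : n.-tuple V) := [set x | A [tuple of x :: X]].
pose K (Y : n.-tuple {set V}) := [set y | B [tuple of y :: Y]].
pose hH X := h <= #|H X|; pose hK Y := 2 ^ (m - h) < #|K Y|.
pose m1 := zero_mass hH hK.
pose m2 := \sum_x zero_mass [pred X | x \in H X] [pred Y | ~~ hK Y && [exists y in K Y, x \notin y]].
pose m3 := \sum_(U : {set V}) zero_mass [pred X | ~~ hH X && ~~ [disjoint H X & U]]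
    [pred Y | hK Y && [disjoint \bigcap_(y in K Y) y & U]].
(* The terms stand for both tails heavy, [Y] light, and [X] light with [Y] heavy; the factor
   [2 ^ (m - h)] is the one in [fiber_light_left]. *)
have split_mass : zero_mass A B * 2 ^ (m - h) <=
    T * m1 * 2 ^ (m - h) + 2 ^ (m - h) * m2 * 2 ^ (m - h) + h * 2 ^ m.-1 * m3.
  rewrite /m2 /m3 -!zero_mass_sum /m1 (zero_mass_indicator hH).
  rewrite zero_mass_fiber !big_distrl !big_distrr !big_distrl -!big_split /=; apply: leq_sum => X _.
  rewrite !big_distrl !big_distrr !big_distrl -!big_split /=; apply: leq_sum => Y _.
  rewrite -/(H X) -/(K Y); case: (zero_pattern X Y); last by rewrite !mul0n.
  rewrite !mul1n; case: (ltnP (2 ^ (m - h)) #|K Y|) => hKY.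
    case: (leqP h #|H X|) => hHX.
      rewrite -addnA; apply: leq_trans (leq_addr _ _); rewrite leq_mul2r; apply/orP; right.
      by rewrite /hH /hK hHX hKY muln1 (leq_trans (fiber_le _ _)) // leq_mul2r max_card orbT.
    apply: leq_trans (leq_addl _ _); apply: leq_trans (fiber_light_left hHX hKY) _.
    by rewrite leq_mul2l; apply/orP; right; apply: leq_sum => U _; rewrite /hH /hK -ltnNge hHX hKY mulnb.
  apply: leq_trans (leq_addr _ _); apply: leq_trans (leq_addl _ _).
  rewrite leq_mul2r; apply/orP; right; apply: leq_trans (fiber_light_right (H X) hKY) _.
  rewrite leq_mul2l; apply/orP; right; apply: leq_sum => x _.
  by rewrite !inE /hK -leqNgt hKY.
have b1 : m1 * 2 ^ (e * s.+1) <= q.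
  apply: (IH _ _ _ _ (robust_free rP)) => X Y hX hY /=.
  rewrite negb_or; apply/andP; split.
    have [x [y []]] := heavy_fiber_bits false hX hY; rewrite !inE => Ax By xy.
    by have := avoid _ _ Ax By; rewrite /pattern /= xy.
  have [x [y []]] := heavy_fiber_bits true hX hY; rewrite !inE => Ax By xy.
  by have := avoid _ _ Ax By; rewrite /pattern /= xy.
(* Here and in [b3] only the bit 0 is known to extend, so [s] drops by one and lightness has to
   supply the missing [2 ^ e]. *)
have b2 : m2 * 2 ^ (e * s) <= m * q.
  rewrite big_distrl -sum_nat_const; apply: leq_sum => x _.
  apply: (IH _ _ _ _ (robust_fixed rP)) => X Y /= xH /andP[_ /exists_inP[y yK xy]].
  rewrite !inE in xH yK.
  by have := avoid _ _ xH yK; rewrite /pattern /= (negbTE xy).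
have b3 : m3 * 2 ^ (e * s) <= 2 ^ m * q.
  have -> : 2 ^ m = #|{set V}| by rewrite -cardsT -powersetT card_powerset cardsT.
  rewrite big_distrl -sum_nat_const; apply: leq_sum => U _.
  apply: (IH _ _ _ _ (robust_fixed rP)) => X Y /= /andP[_ /pred0Pn[x /andP[/= xH xU]]].
  move=> /andP[_ dU]; have /bigcapP xZ : x \notin \bigcap_(y in K Y) y.
    by apply: contraTN xU => xZ; rewrite (disjointFr dU).
  have [y yK xy] : exists2 y, y \in K Y & x \notin y.
    case: (boolP [exists y in K Y, x \notin y]) => [/exists_inP //|].
    rewrite negb_exists_in => /forall_inP no; case: xZ => y /no; by rewrite negbK.
  rewrite !inE in xH yK.
  by have := avoid _ _ xH yK; rewrite /pattern /= (negbTE xy).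
have hlem : h <= m.
  by apply: leq_trans hm; rewrite leq_pmulr // expn_gt0.
have h_gt0 : 0 < h by apply: leq_trans eh; rewrite addn2.
have m_gt0 : 0 < m by apply: leq_trans hlem.
rewrite -(leq_pmul2r (_ : 0 < 2 ^ (m - h))) ?expn_gt0 //.
have ehm : 2 ^ (m - h) * 2 ^ e * m * 2 <= T.
  rewrite /T mulnAC mulnC -!mulnA leq_mul2l; apply/orP; right.
  by rewrite mulnA mulnC -!expnD -expnS leq_exp2l //; lia.
have hem : h * 2 ^ m.-1 * 2 ^ e * 2 ^ m * 2 <= T * 2 ^ (m - h).
  have -> : 2 ^ m = 2 ^ h * 2 ^ (m - h) by rewrite -expnD subnKC.
  rewrite /T; apply: leq_trans (_ : (h * 2 ^ (h + e + 1)) * 2 ^ m.-1 * 2 ^ (m - h) <= _).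
    by rewrite !expnD expn1; nia.
  by rewrite !leq_mul2r hm !orbT.
rewrite mulnS expnD in b1 *.
set E := 2 ^ (e * s) in b1 b2 b3 *; set F := 2 ^ e in b1 ehm hem *.
set D := 2 ^ (m - h) in split_mass ehm hem *; set M := zero_mass A B in split_mass *.
(* Of the target [2 * T * q] the heavy pairs use [T * q] and each light case half of that, by [eh]
   for light [Y] and [hm] for light [X]. *)
have c1 : T * m1 * D * (F * E) * 2 <= T * D * q * 2.
  by have := leq_mul (leqnn (T * D * 2)) b1; lia.
have c2 : D * m2 * D * (F * E) * 2 <= T * D * q.
  have := leq_mul (leqnn (D * F * 2 * D)) b2; have := leq_mul ehm (leqnn (D * q)); lia.
have c3 : h * 2 ^ m.-1 * m3 * (F * E) * 2 <= T * D * q.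
  have := leq_mul (leqnn (h * 2 ^ m.-1 * F * 2)) b3; have := leq_mul hem (leqnn q); lia.
have -> : 2 ^ n.+1 * T ^ n.+1 = 2 * T * q by rewrite /q !expnS; lia.
have := leq_mul split_mass (leqnn (F * E * 2)).
lia.
Qed.
End RectangleBound.

Lemma zero_mass_total (V : finType) n :
  @zero_mass V n predT predT = (#|V| * 2 ^ #|V|.-1) ^ n.
Proof.
elim: n => [|n IH].
  rewrite /zero_mass (eq_bigr (fun=> 1)) => [|X _]; first by rewrite sum_nat_const card_tuple.
  by rewrite (eq_bigr (fun=> 1)) => [|Y _]; rewrite ?sum_nat_const ?card_tuple // [X]tuple0 [Y]tuple0.
rewrite zero_mass_fiber expnS -IH /zero_mass big_distrr; apply: eq_bigr => X _.
rewrite big_distrr; apply: eq_bigr => Y _; rewrite mulnC; congr (_ * _).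
rewrite /fiber -sum_nat_const; apply: eq_big => [x|x _]; first by rewrite inE.
have -> : #|V|.-1 = #|~: [set x]| by rewrite -(cardsC [set x]) cards1.
rewrite -card_subsets; apply: eq_card => y.
by rewrite !inE subsetC sub1set inE.
Qed.

Lemma nth_pattern (V : finType) n (X : n.-tuple V) (Y : n.-tuple {set V}) (i : 'I_n) :
  nth false (pattern X Y) i = (tnth X i \in tnth Y i).
Proof.
have x0 : V := tnth X i.
rewrite (nth_map (x0, set0)) ?size_zip ?size_tuple ?minnn //.
by rewrite nth_zip ?size_tuple //= -!tnth_nth.
Qed.


(** * An unambiguous function with large certificates at zero *)

Lemma card_bigcup_le_sum (I T : finType) (P : pred I) (F : I -> {set T}) :
  #|\bigcup_(i | P i) F i| <= \sum_(i | P i) #|F i|.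
Proof.
elim/big_rec2: _ => [|i n A _ IH]; first by rewrite cards0.
by apply: leq_trans (leq_card_setU _ _) _; rewrite leq_add2l.
Qed.

(** Each of the [#|X| * s] draws made for indices in [X] falls into [E] with chance at most one
    half. *)
Lemma half_dense_avoiders_count (k s : nat) (E X : {set 'I_k}) : 2 * #|E| <= k ->
  #|[set g : {ffun 'I_k * 'I_s -> 'I_k} | [forall p, (p.1 \in X) ==> (g p \in E)]]| * 2 ^ (#|X| * s)
    <= k ^ (k * s).
Proof.
move=> hE.
pose F (p : 'I_k * 'I_s) : {set 'I_k} := if p.1 \in X then E else setT.
have -> : #|[set g : {ffun 'I_k * 'I_s -> 'I_k} | [forall p, (p.1 \in X) ==> (g p \in E)]]|
    = \prod_p #|F p|.
  rewrite -[RHS]big_enum -(big_map (fun p => #|F p|) predT id) -foldrE.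
  rewrite -[RHS](card_family (fun p => mem (F p))); apply: eq_card => g.
  by rewrite !inE; apply: eq_forallb => p; rewrite /F /=; case: ifP; rewrite ?inE.
have -> : 2 ^ (#|X| * s) = \prod_(p : 'I_k * 'I_s) (if p.1 \in X then 2 else 1).
  rewrite -big_mkcond prod_nat_const; congr (2 ^ _).
  rewrite -[s in LHS]card_ord -cardsT -cardsX; apply: eq_card => p; by rewrite !inE andbT.
rewrite -big_split /=.
have -> : k ^ (k * s) = \prod_(p : 'I_k * 'I_s) k.
  by rewrite prod_nat_const card_prod !card_ord.
apply: leq_prod => p _; rewrite /F; case: ifP => _; first by rewrite mulnC.
by rewrite cardsT card_ord muln1.
Qed.

(** Union bound with [r i] the set of [s] random draws for [i]: there are [2 ^ (2 * k)] pairs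
    [(E, X)], and one with [2 * k < #|X| * s] is bad with chance below [2 ^ (- 2 * k)]. *)
Lemma sparse_containment_family (k s : nat) : 0 < k ->
  exists r : 'I_k -> {set 'I_k}, (forall i, #|r i| <= s) /\
    forall E : {set 'I_k}, 2 * #|E| <= k -> #|[set i | r i \subset E]| * s <= 2 * k.
Proof.
move=> k0.
pose r (g : {ffun 'I_k * 'I_s -> 'I_k}) i := [set g (i, j) | j : 'I_s].
pose ok g := [forall E : {set 'I_k}, (2 * #|E| <= k) ==> (#|[set i | r g i \subset E]| * s <= 2 * k)].
case: (pickP ok) => [g /forallP gP|bad].
  exists (r g); split=> [i|E hE]; last by have := gP E; rewrite hE.
  by rewrite -[s in _ <= s]card_ord leq_imset_card.
exfalso.
pose fam (p : {set 'I_k} * {set 'I_k}) :=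
  [set g : {ffun 'I_k * 'I_s -> 'I_k} | [forall q, (q.1 \in p.2) ==> (g q \in p.1)]].
pose big_pair (p : {set 'I_k} * {set 'I_k}) := (2 * #|p.1| <= k) && (2 * k < #|p.2| * s).
have cover : [set: {ffun 'I_k * 'I_s -> 'I_k}] \subset \bigcup_(p | big_pair p) fam p.
  apply/subsetP=> g _; have := bad g; move/negbT; rewrite negb_forall => /existsP[E].
  rewrite negb_imply -ltnNge => /andP[hE hX].
  apply/bigcupP; exists (E, [set i | r g i \subset E]); first by rewrite /big_pair hE.
  rewrite inE; apply/forallP=> -[i j]; apply/implyP => /=; rewrite inE => /subsetP; apply.
  by apply/imsetP; exists j.
have tot : #|[set: {ffun 'I_k * 'I_s -> 'I_k}]| = k ^ (k * s).
  by rewrite cardsT card_ffun card_prod !card_ord.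
have : k ^ (k * s) * 2 ^ (2 * k).+1 <= 2 ^ k * 2 ^ k * k ^ (k * s).
  have card_pairs : #|{: {set 'I_k} * {set 'I_k}}| = 2 ^ k * 2 ^ k.
    by rewrite card_prod -cardsT -powersetT card_powerset cardsT card_ord.
  rewrite -card_pairs -sum_nat_const -{1}tot.
  apply: leq_trans (_ : (\sum_(p | big_pair p) #|fam p|) * 2 ^ (2 * k).+1 <= _).
    rewrite leq_mul2r; apply/orP; right; apply: leq_trans (subset_leq_card cover) _.
    exact: card_bigcup_le_sum.
  rewrite big_distrl big_mkcond /=; apply: leq_sum => -[E X] _; case: ifP => // /andP[/= hE hX].
  apply: leq_trans (half_dense_avoiders_count s X hE).
  by rewrite leq_mul2l leq_exp2l // hX orbT.
rewrite -expnD addnn -mul2n mulnC leq_pmul2r ?expn_gt0 ?k0 //.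
by rewrite leq_exp2l // ltnn.
Qed.

Lemma card_rows (S T : finType) (M : {set S * T}) : #|M| = \sum_a #|[set b | (a, b) \in M]|.
Proof.
under eq_bigr => a _ do rewrite -sum1_card.
by rewrite pair_big_dep -sum1_card; apply: eq_bigl => -[a b]; rewrite /= inE.
Qed.

Lemma sparse_containment_levels (k L : nat) : 0 < k ->
  exists r : nat -> 'I_k -> {set 'I_k}, forall l, l <= L ->
    (forall i, #|r l i| <= 2 ^ l) /\
    (forall E : {set 'I_k}, 2 * #|E| <= k -> #|[set i | r l i \subset E]| * 2 ^ l <= 2 * k).
Proof.
move=> k0.
have [f fP] := fin_all_exists (fun l : 'I_L.+1 => sparse_containment_family (2 ^ l) k0).
exists (fun l => f (inord l)) => l lL; have := fP (inord l).
by rewrite inordK.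
Qed.

Definition certified (C I : finType) (legal : pred I) (cells : I -> {set C})
    (demand : I -> C -> bool) (x : C -> bool) (t : I) : bool :=
  legal t && [forall c in cells t, x c == demand t c].

(** * Certificates for winning rows *)

Section RowGame.
Variables (k L : nat) (r : nat -> 'I_k -> {set 'I_k}).
Hypothesis r_card : forall l i, l <= L -> #|r l i| <= 2 ^ l.
Hypothesis r_sparse : forall l (E : {set 'I_k}), l <= L -> 2 * #|E| <= k ->
  #|[set i | r l i \subset E]| * 2 ^ l <= 2 * k.
Hypothesis L_large : 2 * k < 2 ^ L.

Implicit Types (x : 'I_k * 'I_k -> bool) (E : {set 'I_k}).

(** The shift [l.+1] makes this the first level from which on no [r l i] with [l < L] lies in [E],
    and 0 if none does. *)
Definition depth E (i : 'I_k) : nat := \max_(l < L | r l i \subset E) l.+1.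

Lemma depth_le E i : depth E i <= L.
Proof. by apply/bigmax_leqP => l _; apply: ltn_ord. Qed.

(** Containment at level [L] would give [2 ^ L <= 2 * k], so cutting the maximum at [l < L] loses
    nothing. *)
Lemma depth_gt E i l : l <= L -> 2 * #|E| <= k -> r l i \subset E -> l < depth E i.
Proof.
move=> lL hE rE; have {}lL : l < L.
  rewrite ltn_neqAle lL andbT; apply: contraTneq L_large => el; rewrite -leqNgt -el.
  apply: leq_trans (r_sparse lL hE); rewrite leq_pmull // card_gt0.
  by apply/set0Pn; exists i; rewrite inE.
exact: (bigmax_sup (Ordinal lL)).
Qed.

(** After swapping the sums over rows and levels, sparsity bounds the share of each level by
    [4 * k]. *)
Lemma sum_exp_depth E : 2 * #|E| <= k -> \sum_i 2 ^ depth E i <= k + 4 * k * L.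
Proof.
move=> hE.
have le1 i : 2 ^ depth E i <= 1 + \sum_(l < L | r l i \subset E) 2 ^ l.+1.
  rewrite /depth; elim/big_rec2: _ => // l a b _ IH.
  by rewrite /maxn; case: ifP => _; lia.
apply: leq_trans (_ : \sum_i (1 + \sum_(l < L | r l i \subset E) 2 ^ l.+1) <= _).
  by apply: leq_sum => i _.
rewrite big_split /= sum1_card card_ord leq_add2l.
under eq_bigr => i _ do rewrite big_mkcond.
rewrite exchange_big /=.
rewrite -[L in _ <= _ * L]card_ord mulnC -sum_nat_const; apply: leq_sum => l _.
rewrite -big_mkcond sum_nat_const expnS.
have := r_sparse (ltnW (ltn_ord l)) hE.
have -> : #|[pred i | r l i \subset E]| = #|[set i | r l i \subset E]|.
  by apply: eq_card => i; rewrite !inE.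
lia.
Qed.

Definition zeros x i : {set 'I_k} := [set j | ~~ x (i, j)].

(** A pair [(i, E)] is the claim that row [i] wins with zero set [E]. *)
Definition legal (t : 'I_k * {set 'I_k}) := 2 * #|t.2| <= k.

Definition cells (t : 'I_k * {set 'I_k}) : {set 'I_k * 'I_k} :=
  [set c | (c.1 == t.1) || (c.2 \in r (depth t.2 c.1) t.1)].

Definition demand (t : 'I_k * {set 'I_k}) (c : 'I_k * 'I_k) := (c.1 == t.1) && (c.2 \notin t.2).

Definition holds := certified legal cells demand.

Lemma holds_zeros x i E : holds x (i, E) -> zeros x i = E.
Proof.
case/andP=> _ /forall_inP hx; apply/setP=> j; rewrite inE.
have := hx (i, j); rewrite inE /= eqxx => /(_ isT) /eqP ->.
by rewrite /demand /= eqxx negbK.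
Qed.

Lemma holds_probe x i i' E : holds x (i, E) -> i' != i -> r (depth E i') i \subset zeros x i'.
Proof.
case/andP=> _ /forall_inP hx ii'; apply/subsetP=> j rj; rewrite inE.
have := hx (i', j); rewrite inE /= rj orbT => /(_ isT) /eqP ->.
by rewrite /demand /= (negbTE ii').
Qed.

(* If two rows won, each would have probed the other one strictly deeper than it was probed. *)
Lemma holds_unique x t t' : holds x t -> holds x t' -> t = t'.
Proof.
case: t t' => [i E] [i' E'] hi hi'.
have [ii'|ii'] := eqVneq i i'.
  by rewrite -(holds_zeros hi) -(holds_zeros hi') ii'.
have p1 := holds_probe hi (_ : i' != i); rewrite eq_sym ii' in p1.
have {}p1 := p1 isT; have p2 := holds_probe hi' ii'.
rewrite (holds_zeros hi) in p2; rewrite (holds_zeros hi') in p1.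
have [/andP[lE _] /andP[lE' _]] := (hi, hi').
have := ltn_trans (depth_gt (depth_le _ _) lE' p1) (depth_gt (depth_le _ _) lE p2).
by rewrite ltnn.
Qed.

Lemma card_cells t : legal t -> #|cells t| <= 2 * k + 4 * k * L.
Proof.
move=> lt; have := sum_exp_depth lt; case: t lt => i E lE /= sE.
have -> : 2 * k + 4 * k * L = k + (k + 4 * k * L) by lia.
rewrite /cells (_ : [set c | _] = setX [set i] setT :|: [set c | c.2 \in r (depth E c.1) i]); last first.
  by apply/setP=> c; rewrite !inE andbT.
apply: leq_trans (leq_card_setU _ _) _; apply: leq_add.
  by rewrite cardsX cards1 cardsT card_ord mul1n.
apply: leq_trans sE; rewrite card_rows; apply: leq_sum => a _.
apply: leq_trans (r_card i (depth_le E a)); apply: subset_leq_card; apply/subsetP=> b.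
by rewrite !inE.
Qed.

Lemma cells_neq0 t : 0 < k -> cells t != set0.
Proof.
by case: t => i E k0; apply/set0Pn; exists (i, i); rewrite inE eqxx.
Qed.

Lemma not_holds_zero t : 0 < k -> ~~ holds (fun=> false) t.
Proof.
case: t => i E k0; apply/negP=> ht; have [lE _] := andP ht; move: lE.
rewrite /legal -(holds_zeros ht) (_ : zeros _ _ = setT) ?cardsT ?card_ord /=; first lia.
by apply/setP=> j; rewrite !inE.
Qed.

(** By averaging, [M] covers at most half of some row; ones at exactly the other entries of that row
    make it win. *)
Lemma holds_off (M : {set 'I_k * 'I_k}) : 2 * #|M| < k * k ->
  exists x t, (forall c, c \in M -> x c = false) /\ holds x t.
Proof.
move=> hM; pose row i : {set 'I_k} := [set j | (i, j) \in M].
have [i hi] : exists i, 2 * #|row i| <= k.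
  apply/existsP; apply: contraLR hM; rewrite negb_exists => /forallP no; rewrite -leqNgt.
  rewrite card_rows.
  rewrite big_distrr -{1}[k]card_ord -sum_nat_const; apply: leq_sum => i _.
  by apply: ltnW; rewrite ltnNge no.
exists (demand (i, row i)), (i, row i); split.
  by move=> [a b] ab; rewrite /demand /=; case: eqP => // <-; rewrite inE ab.
by rewrite /holds /certified /legal hi; apply/forall_inP.
Qed.
End RowGame.

(** * From unambiguous rectangles to biclique partitions *)

Lemma min_nat_le (P : nat -> Prop) n : P n -> min_nat P <= n.
Proof.
move=> Pn; rewrite /min_nat; case: ClassicalEpsilon.excluded_middle_informative => // h.
by case: ex_minnP => m _; apply; apply/decideP.
Qed.

Lemma min_natP (P : nat -> Prop) n : P n -> P (min_nat P).
Proof.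
move=> Pn; rewrite /min_nat; case: ClassicalEpsilon.excluded_middle_informative => [h|[]]; last by exists n.
by case: ex_minnP => m /decideP.
Qed.

Lemma colorable_fin (T K : finType) (e : rel T) (f : T -> K) :
  (forall x y, e x y -> f x != f y) -> colorable e #|K|.
Proof. by move=> fe; exists (enum_rank \o f) => x y /fe; rewrite (inj_eq enum_rank_inj). Qed.

Lemma colorable_leq (T : finType) (e : rel T) n n' : n <= n' -> colorable e n -> colorable e n'.
Proof. by move=> nn' [f fe]; exists (widen_ord nn' \o f) => x y /fe. Qed.

Lemma chromatic_number_geq (T : finType) (e : rel T) c : irreflexive e ->
  (forall n, colorable e n -> c <= n) -> c <= chromatic_number e.
Proof.
move=> ei; apply; apply: (@min_natP (colorable e) #|T|).
by apply: (@colorable_fin _ _ _ id) => x y; apply: contraTneq => ->; rewrite ei.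
Qed.

Lemma bp_leq (T J : finType) (e : rel T) (A B : J -> {set T}) : irreflexive e ->
  (forall j a b, a \in A j -> b \in B j -> e a b) ->
  (forall x y, e x y ->
     #|[set j | ((x \in A j) && (y \in B j)) || ((y \in A j) && (x \in B j))]| = 1) ->
  bp e <= #|J|.
Proof.
move=> ei eAB e1; pose J' := [set j | (A j != set0) && (B j != set0)].
apply: leq_trans (max_card (mem J')); apply: min_nat_le.
exists (fun i => A (enum_val i)), (fun i => B (enum_val i)); split=> [i|x y xy].
  have := enum_valP i; rewrite inE => /andP[A0 B0]; do 3?split=> //; last exact: eAB.
  by rewrite -setI_eq0; apply/eqP/setP=> a; rewrite !inE; apply/negP=> /andP[/eAB h /h]; rewrite ei.
rewrite -(e1 x y xy) -(card_imset _ enum_val_inj).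
apply: eq_card => j; apply/imsetP/idP => [[i]|]; first by rewrite !inE => h ->.
rewrite inE => h; have jJ : j \in J'.
  by rewrite inE; apply/andP; case/orP: h => /andP[h1 h2]; split; apply/set0Pn; eexists; eassumption.
by exists (enum_rank_in jJ j); rewrite ?inE enum_rankK_in.
Qed.

(* A double arc u -> v -> u lies in exactly one product of two rectangles, so the double edges have
   at most #|J| ^ 2 bicliques; inside an independent set of double edges every edge is covered once. *)
Lemma unambiguous_arcs_to_graph (T J : finType) (A B : J -> {set T}) (c : nat) :
  0 < c -> (forall j, [disjoint A j & B j]) ->
  (forall u v i j, u \in A i -> v \in B i -> u \in A j -> v \in B j -> i = j) ->
  (forall n, colorable (fun u v => [exists j, ((u \in A j) && (v \in B j)) || ((v \in A j) && (u \in B j))]) n ->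
     c * c <= n) ->
  exists e : rel T, [/\ simple_graph e, bp e <= #|J| * #|J| & c <= chromatic_number e].
Proof.
move=> c0 disj uniq; set e0 := (fun u v => _) => chi.
pose d u v := [exists j, (u \in A j) && (v \in B j)].
have e0d u v : e0 u v = d u v || d v u.
  apply/existsP/orP => [[j /orP[]] h|[/existsP[j h]|/existsP[j h]]].
  - by left; apply/existsP; exists j.
  - by right; apply/existsP; exists j.
  - by exists j; rewrite h.
  - by exists j; rewrite h orbT.
have di u : d u u = false.
  by apply/existsP=> -[j /andP[uA]]; rewrite (disjointFr (disj j) uA).
pose e1 u v := d u v && d v u.
have e1i : irreflexive e1 by move=> u; rewrite /e1 di.
have e1s : symmetric e1 by move=> u v; rewrite /e1 andbC.
case: (classic (forall n, colorable e1 n -> c <= n)) => [chi1|].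
  exists e1; split=> //; last exact: chromatic_number_geq.
  rewrite -card_prod.
  (* Comparing ranks keeps one of [(i, j)] and [(j, i)], which cover the same double edges. *)
  pose A' (p : J * J) := if enum_rank p.1 < enum_rank p.2 then A p.1 :&: B p.2 else set0.
  pose B' (p : J * J) := if enum_rank p.1 < enum_rank p.2 then B p.1 :&: A p.2 else set0.
  apply: (@bp_leq _ _ _ A' B') => // [[i j] a b|x y].
    rewrite /A' /B' /=; case: ifP => _; rewrite !inE // => /andP[ai aj] /andP[bi bj].
    by rewrite /e1; apply/andP; split; apply/existsP; [exists i|exists j]; apply/andP.
  case/andP=> /existsP[i /andP[xi yi]] /existsP[j /andP[yj xj]].
  have ij : nat_of_ord (enum_rank i) != enum_rank j.
    rewrite (inj_eq (@ord_inj _)) (inj_eq enum_rank_inj); apply: contraTneq xj => <-.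
    by rewrite (disjointFr (disj i) xi).
  rewrite -(cards1 (if enum_rank i < enum_rank j then (i, j) else (j, i))).
  apply: eq_card => -[i' j']; rewrite !inE /A' /B' /=.
  case: (ltnP (enum_rank i') (enum_rank j')) => hij'; rewrite !inE /=; last first.
    apply/esym/negbTE; apply: contraTneq hij'; rewrite -ltnNge.
    case: ltnP => h [-> ->] //; by rewrite ltn_neqAle eq_sym ij.
  apply/idP/eqP.
    case/orP=> /andP[/andP[p1 p2] /andP[p3 p4]].
      have ei := uniq _ _ _ _ p1 p3 xi yi; have ej := uniq _ _ _ _ p4 p2 yj xj.
      by rewrite ei ej in hij' *; rewrite hij'.
    have ei := uniq _ _ _ _ p1 p3 yj xj; have ej := uniq _ _ _ _ p4 p2 xi yi.
    by rewrite ei ej in hij' *; rewrite ltnNge ltnW.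
  by case: ifP => _ [-> ->]; rewrite xi xj yi yj ?orbT.
move=> /not_all_ex_not[n /(imply_to_and (colorable e1 n))[[f fe1] /negP]]; rewrite -ltnNge => nc.
(* A class of [f] contains no double edge, so in [e2 a] each edge is an arc in one direction
   only. *)
pose e2 a u v := [&& f u == a, f v == a & e0 u v].
have e2i a : irreflexive (e2 a) by move=> u; rewrite /e2 e0d di /= !andbF.
have e2s a : symmetric (e2 a) by move=> u v; rewrite /e2 !e0d orbC andbCA.
case: (classic (exists a, forall n', colorable (e2 a) n' -> c <= n')) => [[a chi2]|none].
  exists (e2 a); split=> //; last exact: chromatic_number_geq.
  apply: (@leq_trans #|J|); last by case: (#|J|) => // q; rewrite leq_pmulr.
  pose C := [set u | f u == a].
  apply: (@bp_leq _ _ _ (fun j => A j :&: C) (fun j => B j :&: C)) => // [j x y|x y].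
    rewrite !inE => /andP[xA fx] /andP[yB fy]; rewrite /e2 fx fy e0d.
    by apply/orP; left; apply/existsP; exists j; apply/andP.
  case/and3P=> fx fy /existsP[j hj].
  have noe1 : ~~ e1 x y by apply: contraTN fx => /fe1; rewrite (eqP fy).
  rewrite -(cards1 j); apply: eq_card => i; rewrite !inE fx fy !andbT.
  apply/idP/eqP => [hi|-> //].
  case/orP: hi => /andP[p1 p2]; case/orP: hj => /andP[p3 p4].
  - exact: uniq p1 p2 p3 p4.
  - case/negP: noe1; apply/andP; split; apply/existsP; [exists i|exists j]; exact/andP.
  - case/negP: noe1; apply/andP; split; apply/existsP; [exists j|exists i]; exact/andP.
  - exact: uniq p1 p2 p3 p4.
(* If every class had a colouring with [c.-1] colours, pairing it with [f] would colour [e0] with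
   fewer than [c * c] colours. *)
have col a : exists g : T -> 'I_c.-1, forall x y, e2 a x y -> g x != g y.
  apply: NNPP => no; apply: none; exists a => n' cn'; rewrite leqNgt; apply/negP => n'c.
  by apply: no; apply: colorable_leq cn'; rewrite -ltnS prednK.
have [g ge] := fin_all_exists col.
have := chi #|{: 'I_n * 'I_c.-1}|.
rewrite card_prod !card_ord leqNgt => /(_ _)/negP; case; last first.
  by apply: (@leq_ltn_trans (n * c)); rewrite ?leq_mul2l ?leq_pred ?orbT // ltn_pmul2r.
have <- : #|{: 'I_n * 'I_c.-1}| = n * c.-1 by rewrite card_prod !card_ord.
apply: (@colorable_fin _ _ _ (fun u => (f u, g (f u) u))) => u v uv.
apply/eqP=> -[fuv guv]; have := ge (f u) u v.
by rewrite /e2 eqxx -fuv eqxx uv => /(_ isT); rewrite guv -fuv eqxx.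
Qed.

(** * Lifting certificates by the index gadget *)

Section Lift.
Variables (C I V W : finType) (legal : pred I) (cells : I -> {set C}) (demand : I -> C -> bool).
Variables (d : nat) (w0 : W).

Local Notation sat := (certified legal cells demand).

Hypothesis certified_unique : forall x t t', sat x t -> sat x t' -> t = t'.
Hypothesis zero_uncertified : forall t, ~~ sat (fun=> false) t.
Hypothesis certified_off : forall M : {set C}, 2 * #|M| < #|C| ->
  exists x t, (forall c, c \in M -> x c = false) /\ sat x t.
Hypothesis card_cells : forall t, legal t -> #|cells t| <= d.
Hypothesis cells_neq0 : forall t, cells t != set0.
Hypothesis V_large : 2 ^ 3 * 2 ^ (2 ^ 3 + 6 + 1) <= #|V|.

Let n := #|C|.

Lemma eq_certified x x' t : x =1 x' -> sat x t = sat x' t.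
Proof. by move=> xx'; congr (_ && _); apply: eq_forallb => c; rewrite xx'. Qed.

Definition value (X : n.-tuple V) (Y : n.-tuple {set V}) (c : C) : bool :=
  tnth X (enum_rank c) \in tnth Y (enum_rank c).

Lemma zero_patternE (X : n.-tuple V) (Y : n.-tuple {set V}) :
  zero_pattern X Y = [forall c, ~~ value X Y c].
Proof.
have szp : size (pattern X Y) = n by rewrite size_map size_zip !size_tuple minnn.
apply/idP/forallP => [zp c|no].
  apply: contra zp => vc; apply/(has_nthP false); exists (enum_rank c); rewrite ?szp //.
  by rewrite nth_pattern.
apply/(has_nthP false) => -[i]; rewrite szp => lti.
have -> : i = Ordinal lti by [].
by rewrite nth_pattern => h; have := no (enum_val (Ordinal lti)); rewrite /value enum_valK h.
Qed.

Lemma pattern_value (X : n.-tuple V) (Y : n.-tuple {set V}) c :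
  nth false (pattern X Y) (enum_rank c) = value X Y c.
Proof. exact: nth_pattern. Qed.

(** Adjacency ignores the [W] component, which only makes copies of vertices. *)
Definition vertex : finType := (n.-tuple V * n.-tuple {set V} * W)%type.

Definition zero_vertex (u : vertex) := zero_pattern u.1.1 u.1.2.

Definition arc (u v : vertex) :=
  [&& zero_vertex u, zero_vertex v & [exists t, sat (value u.1.1 v.1.2) t]].

(** The default pads the list of cells with one of its members, so every index names a cell of
    [t]. *)
Definition probe (t : I) (i : 'I_d) : C :=
  nth (xchoose (set0Pn _ (cells_neq0 t))) (enum (cells t)) i.

Lemma probe_in t i : probe t i \in cells t.
Proof.
rewrite /probe; set c0 := xchoose _; have c0P : c0 \in cells t := xchooseP (set0Pn _ (cells_neq0 t)).
by case: (ltnP i (size (enum (cells t)))) => h; [rewrite -mem_enum mem_nth|rewrite nth_default].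
Qed.

Lemma probe_onto t c : legal t -> c \in cells t -> exists i, probe t i = c.
Proof.
move=> lt ct; have lti : index c (enum (cells t)) < d.
  by apply: leq_trans (card_cells lt); rewrite cardE index_mem mem_enum.
by exists (Ordinal lti); rewrite /probe nth_index // mem_enum.
Qed.

(** Recording Alice's points at the probed cells in [j.2] turns the joint condition on [u] and [v]
    into one on each side. *)
Definition rect_left (j : I * {ffun 'I_d -> V}) : {set vertex} :=
  [set u | [&& zero_vertex u, legal j.1 &
    [forall i, tnth u.1.1 (enum_rank (probe j.1 i)) == j.2 i]]].

Definition rect_right (j : I * {ffun 'I_d -> V}) : {set vertex} :=
  [set v | zero_vertex v &&
    [forall i, (j.2 i \in tnth v.1.2 (enum_rank (probe j.1 i))) == demand j.1 (probe j.1 i)]].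

Lemma rect_certified u v j : u \in rect_left j -> v \in rect_right j ->
  sat (value u.1.1 v.1.2) j.1.
Proof.
rewrite !inE => /and3P[_ lj /forallP uj] /andP[_ /forallP vj].
rewrite /certified lj; apply/forall_inP => c /(probe_onto lj)[i <-].
by rewrite /value (eqP (uj i)) (eqP (vj i)).
Qed.

Lemma rect_arc u v :
  arc u v = [exists j, (u \in rect_left j) && (v \in rect_right j)].
Proof.
apply/and3P/existsP => [[zu zv /existsP[t ct]]|[j /andP[uj vj]]].
  exists (t, [ffun i => tnth u.1.1 (enum_rank (probe t i))]).
  have [lt /forall_inP tc] := andP ct.
  rewrite !inE zu zv lt /=; apply/andP; split; apply/forallP=> i; rewrite ffunE //.
  exact: tc (probe_in t i).
have zu : zero_vertex u by move: uj; rewrite inE => /andP[].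
have zv : zero_vertex v by move: vj; rewrite inE => /andP[].
by split=> //; apply/existsP; exists j.1; apply: rect_certified uj vj.
Qed.

Lemma rect_unique u v i j : u \in rect_left i -> v \in rect_right i ->
  u \in rect_left j -> v \in rect_right j -> i = j.
Proof.
move=> ui vi uj vj.
have := certified_unique (rect_certified ui vi) (rect_certified uj vj).
case: i j ui uj {vi vj} => [t f] [t' f'] /= ui uj tt'; rewrite {}tt' in ui *.
congr pair; apply/ffunP=> i; move: ui uj; rewrite !inE /=.
by move=> /and3P[_ _ /forallP/(_ i)/eqP <-] /and3P[_ _ /forallP/(_ i)/eqP <-].
Qed.

Lemma arc_irreflexive u : arc u u = false.
Proof.
apply/and3P => -[zu _ /existsP[t]]; apply/negP.
rewrite (@eq_certified _ (fun=> false)) // => c.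
by move: zu; rewrite /zero_vertex zero_patternE => /forallP/(_ c)/negbTE.
Qed.

(** Fewer than [s] entries are less than half of all, so [certified_off] applies; [n.+1] allows [s]
    to be [n / 2] rounded up. *)
Lemma certified_robust s : 2 * s <= n.+1 ->
  robust n s (fun z => [exists t, sat (fun c => nth false z (enum_rank c)) t]).
Proof.
move=> hs M sM cM; pose S := [set c : C | nth false M (enum_rank c)].
have cS : #|S| = count id M.
  rewrite -sum1_count (big_nth false) big_mkord sM -sum1_card (reindex enum_rank) /=; last first.
    exact/onW_bij/enum_rank_bij.
  by apply: eq_bigl => c; rewrite inE.
have [|x [t [x0 xt]]] := @certified_off S; first by rewrite cS; lia.
exists [seq x (enum_val i) | i <- enum 'I_n].
have nthx (i : 'I_n) : nth false [seq x (enum_val j) | j <- enum 'I_n] i = x (enum_val i).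
  by rewrite (nth_map i) ?size_enum_ord // nth_ord_enum.
split; first by rewrite size_map size_enum_ord.
  apply/existsP; exists t; rewrite -(@eq_certified x) // => c.
  by rewrite nthx enum_rankK.
rewrite all2E size_map size_enum_ord sM eqxx; apply/(all_nthP (false, false)) => i.
rewrite size_zip size_map size_enum_ord sM minnn => lti.
rewrite nth_zip /=; last by rewrite size_map size_enum_ord sM.
have /= -> := nthx (Ordinal lti).
apply/negP=> /andP[Mi xi]; move: xi; rewrite x0 // inE enum_valK.
exact: Mi.
Qed.

(** A certified pair in the rectangle spanned by a colour class would give an arc inside the class.
    These rectangles cover all all-zero pairs, and each holds a fraction of at most [4 ^ (- n)]. *)
Lemma arc_coloring_bound N : colorable (fun u v => arc u v || arc v u) N -> 4 ^ n <= N.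
Proof.
move=> [f fe].
pose A (a : 'I_N) (X : n.-tuple V) := [exists Y : n.-tuple {set V}, zero_vertex (X, Y, w0) && (f (X, Y, w0) == a)].
pose B (a : 'I_N) (Y : n.-tuple {set V}) := [exists X : n.-tuple V, zero_vertex (X, Y, w0) && (f (X, Y, w0) == a)].
pose T := (#|V| * 2 ^ #|V|.-1) ^ n.
have tot : T <= \sum_a zero_mass (A a) (B a).
  rewrite /T -zero_mass_total -zero_mass_sum /zero_mass; apply: leq_sum => X _; apply: leq_sum => Y _.
  case: (boolP (zero_pattern X Y)) => // zXY; rewrite mul1n (bigD1 (f (X, Y, w0))) //=.
  apply: leq_trans (leq_addr _ _); rewrite (_ : _ && _) //; apply/andP; split; apply/existsP.
    by exists Y; rewrite /zero_vertex zXY eqxx.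
  by exists X; rewrite /zero_vertex zXY eqxx.
have small a : zero_mass (A a) (B a) * 4 ^ n <= T.
  pose s := uphalf n.
  have hs : 2 * s <= n.+1 by rewrite /s; lia.
  have avoid X Y : A a X -> B a Y -> ~~ [exists t, sat (fun c => nth false (pattern X Y) (enum_rank c)) t].
    case/existsP=> Y1 /andP[z1 f1] /existsP[X2 /andP[z2 f2]].
    apply/negP=> /existsP[t ct].
    have : arc (X, Y1, w0) (X2, Y, w0).
      rewrite /arc z1 z2 /=; apply/existsP; exists t.
      rewrite (@eq_certified _ (fun c => nth false (pattern X Y) (enum_rank c))) // => c.
      by rewrite pattern_value.
    move=> auv; have := fe (X, Y1, w0) (X2, Y, w0); rewrite auv => /(_ isT).
    by rewrite (eqP f1) (eqP f2) eqxx.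
  (* With [e = 6] and [s >= n / 2] the gain is at least [2 ^ (3 * n)], which leaves [4 ^ n] after
     the loss [2 ^ n]. *)
  have := rectangle_bound (h := 2 ^ 3) (e := 6) isT V_large (certified_robust hs) avoid.
  rewrite -/T.
  have -> : 4 ^ n = 2 ^ (2 * n) by rewrite expnM.
  move=> h; rewrite -(leq_pmul2l (_ : 0 < 2 ^ n)) ?expn_gt0 //.
  apply: leq_trans h; rewrite mulnCA -expnD leq_mul2l leq_exp2l //.
  by apply/orP; right; rewrite /s; lia.
have T_gt0 : 0 < T.
  rewrite /T expn_gt0 muln_gt0 expn_gt0 /= andbT.
  by rewrite (leq_trans _ V_large) // muln_gt0 expn_gt0.
have : T * 4 ^ n <= N * T.
  apply: leq_trans (_ : (\sum_a zero_mass (A a) (B a)) * 4 ^ n <= _); first by rewrite leq_mul2r tot orbT.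
  apply: leq_trans (_ : \sum_(a < N) T <= _); last by rewrite sum_nat_const card_ord.
  by rewrite big_distrl; apply: leq_sum.
by rewrite mulnC leq_pmul2r.
Qed.

Lemma lifted_graph : exists e : rel vertex,
  [/\ simple_graph e, bp e <= (#|I| * #|V| ^ d) * (#|I| * #|V| ^ d) & 2 ^ n <= chromatic_number e].
Proof.
have -> : #|I| * #|V| ^ d = #|{: I * {ffun 'I_d -> V}}| by rewrite card_prod card_ffun card_ord.
apply: (@unambiguous_arcs_to_graph _ _ rect_left rect_right); first by rewrite expn_gt0.
- move=> j; apply/pred0P=> u /=; apply/negP=> /andP[uj vj].
  have := arc_irreflexive u; rewrite rect_arc => /existsP; apply; exists j; exact/andP.
- by move=> u v i j; apply: rect_unique.
- move=> N [f fe]; rewrite -expnMn; apply: arc_coloring_bound; exists f => u v.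
  rewrite !rect_arc => h; apply: fe; case/orP: h => /existsP[j h]; apply/existsP; exists j; by rewrite h ?orbT.
Qed.
End Lift.

(** * Choice of parameters *)

Lemma alon_saks_seymour_nat (q k : nat) : 18 <= q -> 2 <= k ->
  let l := trunc_log 2 k in
  exists (T : finType) (e : rel T), [/\ simple_graph e,
    2 ^ (k ^ 4 * l ^ 3) <= #|T|, #|T| <= 2 ^ ((q + 2 ^ q + 1) * (k ^ 4 * l ^ 3)),
    bp e <= 2 ^ ((4 + 28 * q) * (k * l)) & 2 ^ (k ^ 2) <= chromatic_number e].
Proof.
move=> hq hk l; have k0 : 0 < k by apply: ltnW.
have l0 : 0 < l by rewrite trunc_log_gt0 hk.
pose L := l.+2; have hL : 2 * k < 2 ^ L.
  by rewrite /L expnS ltn_pmul2l // trunc_log_ltn.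
have [r hr] := sparse_containment_levels L k0.
have r_card t i : t <= L -> #|r t i| <= 2 ^ t by move=> /hr[].
have r_sparse t (E : {set 'I_k}) : t <= L -> 2 * #|E| <= k ->
  #|[set i | r t i \subset E]| * 2 ^ t <= 2 * k by move=> /hr[_]; apply.
set P := k ^ 4 * l ^ 3; pose d := 2 * k + 4 * k * L.
have V_large : 2 ^ 3 * 2 ^ (2 ^ 3 + 6 + 1) <= #|'I_(2 ^ q)|.
  by rewrite card_ord -expnD leq_exp2l.
have off (M : {set 'I_k * 'I_k}) : 2 * #|M| < #|{: 'I_k * 'I_k}| ->
  exists x t, (forall c, c \in M -> x c = false) /\
    certified (@legal k) (cells L r) (@demand k) x t.
  by rewrite card_prod card_ord => hM; apply: holds_off.
(* Taking [2 ^ P] copies of each vertex brings the order up to the required size. *)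
have [||e [e_simple e_bp e_chi]] := @lifted_graph _ _ 'I_(2 ^ q) {ffun 'I_P -> bool}
  (@legal k) (cells L r) (@demand k) d [ffun=> true] (holds_unique r_sparse hL) _ off
  (@card_cells k L r r_card r_sparse hL) _ V_large.
- by move=> t; apply: not_holds_zero.
- by move=> t; apply: cells_neq0.
have P_ge : k * k <= P.
  by rewrite /P !expnS expn0 !muln1; nia.
have card_cellsT : #|{: 'I_k * 'I_k}| = k * k by rewrite card_prod card_ord.
have cardT : #|vertex ('I_k * 'I_k)%type 'I_(2 ^ q) {ffun 'I_P -> bool}| =
    2 ^ (q * (k * k) + 2 ^ q * (k * k) + P).
  rewrite !card_prod !card_tuple card_ffun card_bool !card_ord.
  rewrite -cardsT -powersetT card_powerset cardsT card_ord.
  by rewrite -!expnM -!expnD.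
exists _, e; split=> //.
- by rewrite cardT leq_exp2l // leq_addl.
- by rewrite cardT leq_exp2l //; nia.
- apply: leq_trans e_bp _; rewrite card_prod card_ord.
  rewrite -cardsT -powersetT card_powerset cardsT !card_ord mulnn.
  (* The exponent is [2 * (2 * k + q * d)], and [d <= 14 * k * l]. *)
  apply: leq_trans (_ : (2 ^ k * 2 ^ k * (2 ^ q) ^ d) ^ 2 <= _).
    by rewrite leq_sqr !leq_mul2r ltnW ?orbT // ltn_expl.
  rewrite -(expnM 2 q d) -!expnD -(expnM 2 _ 2) leq_exp2l //.
  by rewrite /d /L; nia.
by rewrite card_cellsT in e_chi; rewrite -mulnn.
Qed.

(** * Real estimates *)

From Stdlib Require Import Reals Lra.

Lemma INR_expn2 n : INR (expn 2 n) = Rpower 2 (INR n).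
Proof.
rewrite Rpower_pow; last lra.
by elim: n => [|n IH]; rewrite ?expnS ?mult_INR ?IH.
Qed.

Lemma INR_expn a n : INR (expn a n) = (INR a ^ n)%R.
Proof. by elim: n => [|n IH]; rewrite ?expnS ?mult_INR ?IH. Qed.

Lemma ln2_bounds : (/ 2 < ln 2 < 1)%R.
Proof.
split; first exact: ln_lt_2.
rewrite -[X in (_ < X)%R](ln_exp 1); apply: ln_increasing; first lra.
by have := exp_ineq1 1 R1_neq_R0; lra.
Qed.

Lemma ln_le x y : (0 < x)%R -> (x <= y)%R -> (ln x <= ln y)%R.
Proof. by move=> x0 [xy|->]; [left; apply: ln_increasing|right]. Qed.

(** Both follow from [l * ln 2 <= ln k <= (l + 1) * ln 2], where [l >= 1] and [ln 2] lies between
    one half and 1. *)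
Lemma ln_trunc_log_bounds k : (2 <= k)%N ->
  (INR (trunc_log 2 k) <= 2 * ln (INR k))%R /\ (ln (INR k) <= 2 * INR (trunc_log 2 k))%R.
Proof.
move=> hk; set l := trunc_log 2 k; have [h1 h2] := ln2_bounds.
have k0 : (0 < INR k)%R by apply: lt_0_INR; apply/ltP; apply: ltnW.
have l1 : (1 <= INR l)%R by apply: (le_INR 1); apply/leP; rewrite trunc_log_gt0 hk.
have lnp n : ln (INR (expn 2 n)) = (INR n * ln 2)%R by rewrite INR_expn2 /Rpower ln_exp.
have lo : (INR l * ln 2 <= ln (INR k))%R.
  rewrite -lnp; apply: ln_le; last by apply: le_INR; apply/leP; rewrite trunc_logP // ltnW.
  by apply: lt_0_INR; apply/ltP; rewrite expn_gt0.
have hi : (ln (INR k) <= (INR l + 1) * ln 2)%R.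
  by rewrite -S_INR -lnp; apply: ln_le => //; apply: le_INR; apply/leP; rewrite ltnW // trunc_log_ltn.
split; nra.
Qed.

Lemma Rpower2_le x y : (x <= y)%R -> (Rpower 2 x <= Rpower 2 y)%R.
Proof. by apply: Rle_Rpower; lra. Qed.

Lemma INR_leq_Rpower2 m n x : (m <= expn 2 n)%N -> (INR n <= x)%R -> (INR m <= Rpower 2 x)%R.
Proof.
move=> mn nx; apply: Rle_trans (_ : (INR (expn 2 n) <= _)%R); first by apply: le_INR; apply/leP.
by rewrite INR_expn2; apply: Rpower2_le.
Qed.

Lemma Rpower2_leq_INR m n x : (expn 2 n <= m)%N -> (x <= INR n)%R -> (Rpower 2 x <= INR m)%R.
Proof.
move=> mn nx; apply: Rle_trans (_ : (Rpower 2 (INR n) <= _)%R); first exact: Rpower2_le.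
by rewrite -INR_expn2; apply: le_INR; apply/leP.
Qed.

Theorem theorem1p8 :
  exists C1 C2 C3 c : R,
    (0 < C1)%R /\ (0 < C2)%R /\ (0 < C3)%R /\ (0 < c)%R /\
    forall k : nat, (2 <= k)%N ->
      exists (T : finType) (e : rel T),
        simple_graph e /\
        (Rpower 2 (c * INR k ^ 4 * ln (INR k) ^ 3) <= INR #|T|)%R /\
        (INR #|T| <= Rpower 2 (C1 * INR k ^ 4 * ln (INR k) ^ 3))%R /\
        (INR (bp e) <= Rpower 2 (C2 * INR k * ln (INR k) ^ 4))%R /\
        (Rpower 2 (C3 * INR k ^ 2) <= INR (chromatic_number e))%R.
Proof.
(* Keeping [q] abstract avoids computing [expn 2 18] in unary. *)
have [q hq] : exists q, (18 <= q)%N by exists 18.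
set K1 := INR (q + expn 2 q + 1); set K2 := INR (4 + 28 * q).
have K1_gt0 : (0 < K1)%R by apply: lt_0_INR; apply/ltP; rewrite addn1.
have K2_gt0 : (0 < K2)%R by apply: lt_0_INR; apply/ltP.
exists (8 * K1)%R, (16 * K2)%R, 1%R, (/ 8)%R.
do 4?[split; first lra] => k hk.
have [T [e [es lT uT ube lchi]]] := alon_saks_seymour_nat hq hk.
have [h1 h2] := ln_trunc_log_bounds hk.
set l := trunc_log 2 k in lT uT ube h1 h2.
have l1 : (1 <= INR l)%R by apply: (le_INR 1); apply/leP; rewrite trunc_log_gt0 hk.
have k0 : (0 <= INR k)%R by apply: pos_INR.
have ln2k : (1 <= 2 * ln (INR k))%R by lra.
have k4 : (0 <= INR k ^ 4)%R by apply: pow_le.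
have cube_lo : (ln (INR k) ^ 3 <= 8 * INR l ^ 3)%R.
  have := pow_incr (ln (INR k)) (2 * INR l) 3; rewrite Rpow_mult_distr; lra.
have cube_hi : (INR l ^ 3 <= 8 * ln (INR k) ^ 3)%R.
  have := pow_incr (INR l) (2 * ln (INR k)) 3; rewrite Rpow_mult_distr; lra.
(* Since [2 * ln k >= 1], the bound with [k * l] weakens to the fourth power of the logarithm. *)
have quartic : (INR l <= 16 * ln (INR k) ^ 4)%R.
  have c1 : (1 <= 8 * ln (INR k) ^ 3)%R.
    have := pow_R1_Rle (2 * ln (INR k)) 3 ln2k; rewrite Rpow_mult_distr; lra.
  have -> : (16 * ln (INR k) ^ 4 = (8 * ln (INR k) ^ 3) * (2 * ln (INR k)))%R by ring.
  nra.
exists T, e; split=> //; split; [|split; [|split]].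
- apply: Rpower2_leq_INR lT _; rewrite mult_INR !INR_expn; nra.
- apply: INR_leq_Rpower2 uT _; rewrite 2!mult_INR !INR_expn -/K1.
  have := Rmult_le_compat_l (K1 * INR k ^ 4) _ _ _ cube_hi; nra.
- apply: INR_leq_Rpower2 ube _; rewrite 2!mult_INR -/K2.
  have := Rmult_le_compat_l (K2 * INR k) _ _ _ quartic; nra.
- apply: Rpower2_leq_INR lchi _; rewrite INR_expn; lra.
Qed.
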